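(* We have $$A_{(1,1)}(n)=\frac{243\cdot 6.75^n}{4\sqrt{3\pi}\,n^{3/2}}-\frac{337041\cdot 6.75^n}{288\sqrt{3\pi}\,n^{5/2}}+O\left(\frac{6.75^n}{n^{7/2}}\right),$$ where the implicit constant of the error term always lies between $0$ and $\frac{1348164}{36\sqrt{3\pi}}$ for all $n\in\mathbb{N}$; i.e. for every $n\in\mathbb{N}$ the error term equals $\theta_n\,6.75^n/n^{7/2}$ with $0\le\theta_n\le \frac{1348164}{36\sqrt{3\pi}}$. That is, for all sufficiently large $n$, $$\left(\frac{243\cdot 6.75^n}{4\sqrt{3\pi}\,n^{3/2}}\right)\left(1-\frac{1387}{72n}\right)<A_{(1,1)}(n)<\left(\frac{243\cdot 6.75^n}{4\sqrt{3\pi}\,n^{3/2}}\right)\left(1-\frac{1387}{72n}+\frac{5548}{9n^2}\right).$$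
   Context: Here $\mathbb{N}=\{1,2,3,\dots\}$ and $6.75$ means exactly $27/4$. The tree $\mathbf{T}_{(1,1)}$: the root carries the number $1$ and has a single child carrying $1$. Recursively, if $x$ is the parent of $y$, then $y$ has two children: $|x-y|$ (left branch) and $x+y$ (right branch). A parent-child pair $(a,b)$ is at depth $n$ if there is a walk from the root $g_0=1,g_1=1,\dots,g_{n+1}$ with $g_n=a$, $g_{n+1}=b$; occurrences at different positions of the tree (i.e. for different sequences of $n$ left/right choices) are counted separately. $A_{(1,1)}(n)$ is the number of $(1,1)$ pairs at depth $3n$ in $\mathbf{T}_{(1,1)}$ (for example $A_{(1,1)}(1)=5$). *)

(* Defs.v *)
From Stdlib Require Import ZArith List.
Import ListNotations.
Local Open Scope Z_scope.

(* A parent-child pair (x, y) is followed by (y, |x - y|) on the left branch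
   and by (y, x + y) on the right branch. *)
Definition children (p : Z * Z) : list (Z * Z) :=
  let (x, y) := p in [(y, Z.abs (x - y)); (y, x + y)].

(* The list of all pairs (g_n, g_{n+1}) of T_(1,1), with one entry for each of
   the 2 ^ n sequences of left/right choices; thus equal pairs at different
   positions of the tree are listed separately. *)
Fixpoint pairs_at_depth (n : nat) : list (Z * Z) :=
  match n with
  | O => [(1, 1)]
  | S m => flat_map children (pairs_at_depth m)
  end.

Definition pair_eq_dec (p q : Z * Z) : {p = q} + {p <> q}.
Proof. decide equality; apply Z.eq_dec. Defined.

Definition A11 (n : nat) : nat :=
  count_occ pair_eq_dec (pairs_at_depth (3 * n)) (1, 1).

Example A11_1 : A11 1 = 5%nat.
Proof. reflexivity. Qed.

(* Main.v *)
(* A pair and the pair two left turns past its right child coincide, so the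
   walks from (1, 1) move on a tree of directed triangles, and only the number
   of left turns back to (1, 1) matters. Counting walks by this height gives
   A(n) = sum_k (1 - k) C(3n+2, n-k), the coefficient of u^n in
   (1 + u)^(3n+2) (1 - 2u) / (1 - u)^2.

   Summing the series, A(n) is a combination of d(n) = C(3n+2, n) and of the
   partial sum of the row 3n+2 up to n. The latter satisfies a recurrence
   P(n+1) = 8 P(n) - (hypergeometric term), whereas A(n) = O(6.75^n). As
   8 > 6.75, any rational function times d(n) that is a sub- or supersolution of
   the recurrence bounds A(n) from the corresponding side. Finally d(n) is
   squeezed by the limit of d(n) sqrt(n) (4/27)^n, computed from Stirling's
   formula with Wallis's constant, and by the monotonicity of its quotients with
   explicit corrections in 1/n. *)
Require Import Defs.
From Stdlib Require Import Reals Lra Lia Psatz ZArith List.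
From Coquelicot Require Import Coquelicot.
Import ListNotations.
Local Open Scope R_scope.

(** * Pascal triangles with arbitrary initial series *)

(* The coefficient of [u ^ k] in [(1 + u) ^ N * sum_j f j * u ^ j]. *)
Fixpoint pascal (f : nat -> R) (N k : nat) : R :=
  match N, k with
  | O, _ => f k
  | S _, O => f O
  | S N', S k' => pascal f N' (S k') + pascal f N' k'
  end.

Definition binom : nat -> nat -> R :=
  pascal (fun k => match k with O => 1 | S _ => 0 end).

(** The initial series is [1 / (1 - u)], so the entry is the partial row sum of [C(N, i)] over
    [i <= k]. *)
Definition binom_sum : nat -> nat -> R := pascal (fun _ => 1).

(* [1 - k] is the coefficient of [u ^ k] in [(1 - 2 u) / (1 - u) ^ 2]. *)
Definition returns_coef : nat -> nat -> R := pascal (fun k => 1 - INR k).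

Lemma pascal_0 f N : pascal f N 0 = f O.
Proof. destruct N; reflexivity. Qed.

Lemma pascal_S f N k :
  pascal f (S N) (S k) = pascal f N (S k) + pascal f N k.
Proof. reflexivity. Qed.

Lemma binom_0 N : binom N 0 = 1.
Proof. apply pascal_0. Qed.

Lemma binom_S N k : binom (S N) (S k) = binom N (S k) + binom N k.
Proof. reflexivity. Qed.

(** Written with a real difference, the identity also holds for [k > N]; at [N = k] it yields the
    vanishing of entries beyond the diagonal. *)
Lemma binom_succ_r N k :
  (INR k + 1) * binom N (S k) = (INR N - INR k) * binom N k.
Proof.
  revert k; induction N as [|N IH]; intros [|k].
  - unfold binom; cbn [pascal]; change (INR 0) with 0; ring.
  - unfold binom; cbn [pascal]; ring.
  - rewrite binom_S, S_INR, Rmult_plus_distr_l, IH, !binom_0.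
    change (INR 0) with 0; ring.
  - rewrite !binom_S, Rmult_plus_distr_l, (IH (S k)), !S_INR.
    pose proof (IH k); lra.
Qed.

Lemma binom_succ_l N k :
  (INR N + 1 - INR k) * binom (S N) k = (INR N + 1) * binom N k.
Proof.
  destruct k as [|k].
  - rewrite !binom_0; simpl; ring.
  - rewrite binom_S, S_INR. pose proof (binom_succ_r N k); lra.
Qed.

Lemma binom_gt k : binom k (S k) = 0.
Proof.
  pose proof (binom_succ_r k k) as H. pose proof (pos_INR k).
  assert (H1 : (INR k + 1) * binom k (S k) = 0) by lra.
  apply Rmult_integral in H1; destruct H1; lra.
Qed.

Lemma binom_diag k : binom k k = 1.
Proof.
  induction k as [|k IH]; [reflexivity|].
  rewrite binom_S, binom_gt, IH; ring.
Qed.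

Lemma binom_fact i j :
  binom (i + j) i = INR (fact (i + j)) / (INR (fact i) * INR (fact j)).
Proof.
  induction j as [|j IH].
  - rewrite Nat.add_0_r, binom_diag; simpl; field; apply INR_fact_neq_0.
  - rewrite Nat.add_succ_r.
    pose proof (binom_succ_l (i + j) i) as H. rewrite IH in H.
    rewrite plus_INR in H.
    change (fact (S (i + j))) with (S (i + j) * fact (i + j))%nat.
    change (fact (S j)) with (S j * fact j)%nat.
    rewrite !mult_INR, !S_INR, plus_INR.
    pose proof (pos_INR j).
    replace (INR i + INR j + 1 - INR i) with (INR j + 1) in H by ring.
    apply Rmult_eq_reg_l with (INR j + 1); [|lra].
    rewrite H. field; repeat split; try apply INR_fact_neq_0; lra.
Qed.

Lemma binom_pos i j : 0 < binom (i + j) i.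
Proof.
  rewrite binom_fact.
  apply Rdiv_lt_0_compat; [|apply Rmult_lt_0_compat]; apply INR_fact_lt_0.
Qed.

Lemma binom_sum_succ_r N k :
  binom_sum N (S k) = binom_sum N k + binom N (S k).
Proof.
  revert k; induction N as [|N IH]; intros k.
  - unfold binom_sum, binom; simpl; ring.
  - unfold binom_sum in *. rewrite pascal_S, binom_S, IH.
    destruct k as [|k]; [rewrite !pascal_0, binom_0; ring|].
    rewrite pascal_S, IH; ring.
Qed.

(** By Pascal's rule every entry of row [N] enters the next partial sum twice, except the last one,
    which enters once. *)
Lemma binom_sum_succ_l N k :
  binom_sum (S N) (S k) = 2 * binom_sum N (S k) - binom N (S k).
Proof.
  rewrite (binom_sum_succ_r N k); unfold binom_sum at 1; rewrite pascal_S.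
  fold binom_sum; rewrite (binom_sum_succ_r N k); ring.
Qed.

(* For [u] in (0, 1] the sum is at most [(1 + u) ^ N / u ^ k]; here [u = 1 / 2]. *)
Lemma binom_sum_le N k : 0 <= binom_sum N k <= 2 ^ k * (3 / 2) ^ N.
Proof.
  revert k; induction N as [|N IH]; intros k.
  - unfold binom_sum; simpl. pose proof (pow_R1_Rle 2 k). lra.
  - destruct k as [|k].
    + unfold binom_sum; simpl.
      pose proof (pow_R1_Rle (3 / 2) N). lra.
    + unfold binom_sum in *. rewrite pascal_S.
      pose proof (IH k); pose proof (IH (S k)); simpl in *. lra.
Qed.

Lemma binom_le_sum N k : binom N k <= binom_sum N k.
Proof.
  destruct k as [|k]; [rewrite binom_0; unfold binom_sum; rewrite pascal_0; lra|].
  rewrite binom_sum_succ_r. pose proof (binom_sum_le N k); lra.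
Qed.

(** The left side is twice the sum of [(1 - k + j) C(N, j)] over [j <= k]. Since
    [j C(N, j) = N C(N-1, j-1)], the part weighted by [j] is half of [N] times the partial row sum,
    up to a boundary term. *)
Lemma returns_coef_binom_sum N k :
  2 * returns_coef N k =
  (INR N + 2 - 2 * INR k) * binom_sum N k - (INR N - INR k) * binom N k.
Proof.
  revert k; induction N as [|N IH]; intros k.
  - unfold returns_coef, binom_sum, binom; destruct k; cbn [pascal];
      change (INR 0) with 0; ring.
  - destruct k as [|k].
    + unfold returns_coef, binom_sum; rewrite binom_0, !pascal_0, !S_INR.
      change (INR 0) with 0; ring.
    + unfold returns_coef, binom_sum in *. rewrite !pascal_S, binom_S, !S_INR.
      rewrite Rmult_plus_distr_l, !IH, !S_INR.
      fold binom_sum. rewrite (binom_sum_succ_r N k). ring.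
Qed.

(** Multiplying the generating series by [(1 - u)^2] leaves [(1 + u)^N (1 - 2u)]; these are the
    coefficients of [u^(k+2)]. *)
Lemma returns_coef_diff N k :
  returns_coef N (S (S k)) - 2 * returns_coef N (S k) + returns_coef N k =
  binom N (S (S k)) - 2 * binom N (S k).
Proof.
  (* The same comparison at [u^1], where the third term is absent; the case [k = 0] of the induction
     needs it. *)
  assert (H : forall N, returns_coef N 1 - 2 * returns_coef N 0 = binom N 1 - 2).
  { intros M; induction M as [|M IH].
    - unfold returns_coef, binom; simpl; ring.
    - unfold returns_coef in *; rewrite pascal_S, binom_S, binom_0, !pascal_0 in *.
      simpl INR in *; lra. }
  revert k; induction N as [|N IH]; intros k.
  - unfold returns_coef, binom; cbn [pascal]; rewrite !S_INR; ring.
  - destruct k as [|k].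
    + pose proof (IH O); pose proof (H N). unfold returns_coef in *.
      rewrite !pascal_S, !binom_S, binom_0, !pascal_0 in *. simpl INR in *; lra.
    + pose proof (IH k); pose proof (IH (S k)). unfold returns_coef in *.
      rewrite !pascal_S, !binom_S in *. lra.
Qed.

(* [(1 + u) ^ 2 - 4 u = (1 - u) ^ 2] reduces this to
   [binom (3 k + 2) (k + 1) = 2 * binom (3 k + 2) k]. *)
Lemma returns_coef_quadruple k :
  returns_coef (3 * k + 4) (S k) = 4 * returns_coef (3 * k + 2) k.
Proof.
  assert (Hb : binom (3 * k + 2) (S k) = 2 * binom (3 * k + 2) k).
  { pose proof (binom_succ_r (3 * k + 2) k) as H.
    rewrite plus_INR, mult_INR in H; simpl (INR 3) in H; simpl (INR 2) in H.
    pose proof (pos_INR k).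
    apply Rmult_eq_reg_l with (INR k + 1); [rewrite H; ring | lra]. }
  replace (3 * k + 4)%nat with (S (S (3 * k + 2))) by lia.
  set (N := (3 * k + 2)%nat) in *.
  unfold returns_coef; rewrite !pascal_S.
  destruct k as [|k].
  - unfold N; simpl; ring.
  - rewrite pascal_S; fold returns_coef.
    pose proof (returns_coef_diff N k). lra.
Qed.

(** * Counting returning walks by height *)

Definition returns (m : nat) (p : Z * Z) : nat :=
  count_occ pair_eq_dec (Nat.iter m (flat_map children) [p]) (1, 1)%Z.

Lemma iter_flat_map_app {A : Type} (f : A -> list A) m l1 l2 :
  Nat.iter m (flat_map f) (l1 ++ l2) =
  Nat.iter m (flat_map f) l1 ++ Nat.iter m (flat_map f) l2.
Proof.
  induction m as [|m IH]; [reflexivity|].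
  simpl; rewrite IH; apply flat_map_app.
Qed.

Lemma returns_S m x y :
  returns (S m) (x, y) = (returns m (y, Z.abs (x - y)) + returns m (y, x + y)%Z)%nat.
Proof.
  unfold returns; rewrite Nat.iter_succ_r.
  change (flat_map children [(x, y)]) with ([(y, Z.abs (x - y))] ++ [(y, x + y)%Z]).
  rewrite iter_flat_map_app; apply count_occ_app.
Qed.

Lemma A11_returns n : A11 n = returns (3 * n) (1, 1)%Z.
Proof.
  reflexivity.
Qed.

(* [height h p] means that [h] left steps lead from [p] to [(1, 1)] without
   visiting [(1, 0)] and [(0, 1)]. *)
Inductive height : nat -> Z * Z -> Prop :=
| height_root : height 0 (1, 1)%Z
| height_right h x y : height h (x, y) -> height (S (S h)) (y, x + y)%Z
| height_right_left h x y : height h (x, y) -> height (S h) (x + y, x)%Z.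

Lemma height_pos h x y : height h (x, y) -> (1 <= x /\ 1 <= y)%Z.
Proof.
  intros H; remember (x, y) as p eqn:E; revert x y E.
  induction H as [|h x y H IH|h x y H IH]; intros x' y' E; injection E as <- <-;
    [lia| |]; specialize (IH x y eq_refl); lia.
Qed.

(** The directed triangle: [(y, x + y)] goes left to [(x + y, x)], which goes left to [(x, y)].
    Positivity of the entries resolves the absolute value. *)
Lemma height_left h x y : height (S h) (x, y) -> height h (y, Z.abs (x - y)).
Proof.
  intros H; inversion H as [|h' x' y' H' |h' x' y' H']; subst.
  - replace (Z.abs (x - (x' + x))) with x' by (apply height_pos in H'; lia).
    rewrite Z.add_comm. rewrite (Z.add_comm x x'). apply height_right_left, H'.
  - replace (Z.abs (y + y' - y)) with y' by (apply height_pos in H'; lia).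
    exact H'.
Qed.

Lemma height_0 x y : height 0 (x, y) -> x = 1%Z /\ y = 1%Z.
Proof. intros H; inversion H; auto. Qed.

(** A step lowers the height by at most one, so fewer than [h] steps cannot reach height 0. *)
Lemma returns_lt_height m h p : height h p -> (m < h)%nat -> returns m p = 0%nat.
Proof.
  revert h p; induction m as [|m IH]; intros [|h] [x y] H Hlt; try lia.
  - unfold returns; apply count_occ_not_In; intros [E|[]]; injection E as -> ->.
    inversion H as [|h' x' y' H' |h' x' y' H']; subst; apply height_pos in H'; lia.
  - rewrite returns_S, (IH h), (IH (S (S (S h)))); try lia.
    + apply height_right, H.
    + apply height_left, H.
Qed.

(** Above height 0, a left step keeps [n] and a right step, which raises the height by two, lowers
    [n] by one: this is the recursion of [pascal]. The row shift by 2 makes the exceptional left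
    step from the root fit the same rule. *)
Lemma returns_height m n h p :
  height h p -> m = (3 * n + h)%nat -> INR (returns m p) = returns_coef (m + 2) n.
Proof.
  revert n h p; induction m as [m IH] using lt_wf_ind; intros n h [x y] H E.
  destruct m as [|m].
  { assert (h = 0%nat) by lia; assert (n = 0%nat) by lia; subst.
    apply height_0 in H as [-> ->]. unfold returns_coef; simpl; ring. }
  rewrite returns_S, plus_INR.
  destruct h as [|h].
  - destruct n as [|n]; [lia|].
    pose proof (height_0 _ _ H) as [-> ->].
    replace (m + 2)%nat with (3 * n + 4)%nat by lia.
    rewrite (IH m ltac:(lia) n 2%nat (1, 1 + 1)%Z); [|apply height_right, H|lia].
    (* The left child of the root is [(1, 0)]; both of its children are [(0, 1)], and all four
       grandchildren are [(1, 1)]. This detour thus contributes four times the count for [3 n]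
       steps, which [returns_coef_quadruple] turns into the entry that Pascal's rule requires. *)
    assert (Hm : m = S (S (3 * n))) by lia. rewrite Hm at 1.
    change (Z.abs (1 - 1)) with 0%Z.
    rewrite !returns_S; simpl Z.sub; simpl Z.add; simpl Z.abs.
    rewrite !plus_INR, (IH (3 * n)%nat ltac:(lia) n 0%nat); [|exact H|lia].
    replace (S m + 2)%nat with (S (3 * n + 4)) by lia.
    replace (m + 2)%nat with (3 * n + 4)%nat by lia.
    unfold returns_coef at 6; rewrite pascal_S; fold returns_coef.
    rewrite returns_coef_quadruple; ring.
  - rewrite (IH m ltac:(lia) n h); [|apply height_left, H|lia].
    replace (S m + 2)%nat with (S (m + 2)) by lia.
    destruct n as [|n].
    + rewrite (returns_lt_height m (S (S (S h)))); [|apply height_right, H|lia].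
      unfold returns_coef; rewrite !pascal_0; simpl; ring.
    + rewrite (IH m ltac:(lia) n (S (S (S h)))); [|apply height_right, H|lia].
      unfold returns_coef; rewrite pascal_S; reflexivity.
Qed.

Lemma A11_returns_coef n : INR (A11 n) = returns_coef (3 * n + 2) n.
Proof.
  rewrite A11_returns. apply returns_height with O; [constructor|lia].
Qed.

(** * Recurrences along the row [3 n + 2] *)

Definition top_binom (n : nat) : R := binom (3 * n + 2) n.

Lemma INR_3n_2 n : INR (3 * n + 2) = 3 * INR n + 2.
Proof. rewrite plus_INR, mult_INR; simpl; ring. Qed.

Lemma top_binom_pos n : 0 < top_binom n.
Proof.
  unfold top_binom. replace (3 * n + 2)%nat with (n + (2 * n + 2))%nat by lia.
  apply binom_pos.
Qed.

Lemma top_binom_S n :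
  top_binom (S n) =
  3 * (3 * INR n + 5) * (3 * INR n + 4) / ((2 * INR n + 4) * (2 * INR n + 3))
    * top_binom n.
Proof.
  unfold top_binom. replace (3 * S n + 2)%nat with (S (S (S (3 * n + 2)))) by lia.
  pose proof (INR_3n_2 n) as HN. set (N := (3 * n + 2)%nat) in *.
  pose proof (binom_succ_l N n) as H1.
  pose proof (binom_succ_l (S N) n) as H2.
  pose proof (binom_succ_l (S (S N)) n) as H3.
  pose proof (binom_succ_r (S (S (S N))) n) as H4.
  rewrite !S_INR, HN in *. pose proof (pos_INR n). set (x := INR n) in *.
  assert (E1 : binom (S N) n = (3 * x + 3) / (2 * x + 3) * binom N n).
  { apply Rmult_eq_reg_l with (2 * x + 3); [|lra].
    transitivity ((3 * x + 2 + 1) * binom N n); [rewrite <- H1; ring|].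
    field; lra. }
  assert (E2 : binom (S (S N)) n = (3 * x + 4) / (2 * x + 4) * binom (S N) n).
  { apply Rmult_eq_reg_l with (2 * x + 4); [|lra].
    transitivity ((3 * x + 2 + 1 + 1) * binom (S N) n); [rewrite <- H2; ring|].
    field; lra. }
  assert (E3 : binom (S (S (S N))) n = (3 * x + 5) / (2 * x + 5) * binom (S (S N)) n).
  { apply Rmult_eq_reg_l with (2 * x + 5); [|lra].
    transitivity ((3 * x + 2 + 1 + 1 + 1) * binom (S (S N)) n); [rewrite <- H3; ring|].
    field; lra. }
  apply Rmult_eq_reg_l with (x + 1); [|lra].
  rewrite H4, E3, E2, E1. field; lra.
Qed.

(** Descending three rows doubles the partial sum three times, whence the factor 8; the boundary
    entries lost and gained are rational multiples of [top_binom n]. *)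
Lemma binom_sum_top_S n :
  binom_sum (3 * S n + 2) (S n) =
  8 * binom_sum (3 * n + 2) n
    - (5 * INR n + 6) / (2 * INR n + 3) * top_binom n.
Proof.
  unfold top_binom. replace (3 * S n + 2)%nat with (S (S (S (3 * n + 2)))) by lia.
  pose proof (INR_3n_2 n) as HN. set (N := (3 * n + 2)%nat) in *.
  pose proof (binom_succ_l N n) as H1.
  pose proof (binom_succ_r N n) as H2.
  rewrite HN in *. pose proof (pos_INR n). set (x := INR n) in *.
  assert (E1 : binom (S N) n = (3 * x + 3) / (2 * x + 3) * binom N n).
  { apply Rmult_eq_reg_l with (2 * x + 3); [|lra].
    transitivity ((3 * x + 2 + 1) * binom N n); [rewrite <- H1; ring|].
    field; lra. }
  assert (E2 : binom N (S n) = 2 * binom N n).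
  { apply Rmult_eq_reg_l with (x + 1); [rewrite H2; ring | lra]. }
  rewrite !binom_sum_succ_l, binom_sum_succ_r, !binom_S, E1, E2.
  field; lra.
Qed.

(* Dividing by [n + 4] makes the coefficient in [returns_rate_S] constant. *)
Definition returns_rate (n : nat) : R := returns_coef (3 * n + 2) n / (INR n + 4).

Lemma returns_rate_binom_sum n :
  returns_rate n =
  binom_sum (3 * n + 2) n / 2 - (INR n + 1) / (INR n + 4) * top_binom n.
Proof.
  unfold returns_rate, top_binom. pose proof (returns_coef_binom_sum (3 * n + 2) n) as H.
  rewrite INR_3n_2 in H. pose proof (pos_INR n).
  apply Rmult_eq_reg_l with (2 * (INR n + 4)); [|lra].
  transitivity (2 * returns_coef (3 * n + 2) n); [field; lra|].
  rewrite H; field; lra.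
Qed.

Lemma returns_rate_S n :
  returns_rate (S n) =
  8 * returns_rate n +
  (8 * (INR n + 1) / (INR n + 4) - (5 * INR n + 6) / (2 * (2 * INR n + 3))
   - (INR n + 2) / (INR n + 5) * (3 * (3 * INR n + 5) * (3 * INR n + 4)
       / ((2 * INR n + 4) * (2 * INR n + 3)))) * top_binom n.
Proof.
  rewrite !returns_rate_binom_sum, binom_sum_top_S, top_binom_S, S_INR.
  pose proof (pos_INR n). field; lra.
Qed.

(** The point [u = 1 / 2] minimises [(1 + u)^3 / u], with minimum [27 / 4], so the bound has the
    exact growth rate. *)
Lemma binom_sum_top_le n : binom_sum (3 * n + 2) n <= 9 / 4 * (27 / 4) ^ n.
Proof.
  pose proof (binom_sum_le (3 * n + 2) n) as [_ H].
  rewrite pow_add, pow_mult in H.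
  replace (2 ^ n * (((3 / 2) ^ 3) ^ n * (3 / 2) ^ 2))
    with (9 / 4 * (2 ^ n * ((3 / 2) ^ 3) ^ n)) in H by field.
  rewrite <- Rpow_mult_distr in H.
  replace (2 * (3 / 2) ^ 3) with (27 / 4) in H by field. exact H.
Qed.

(** * Sub- and supersolutions of the recurrence *)

(** A positive value would be multiplied by at least 8 at each step and eventually exceed any
    multiple of [(27 / 4) ^ n]. *)
Lemma growth_nonpos (e : nat -> R) (M : R) :
  (forall n, (1 <= n)%nat -> 8 * e n <= e (S n)) ->
  (forall n, (1 <= n)%nat -> e n <= M * (27 / 4) ^ n) ->
  forall n, (1 <= n)%nat -> e n <= 0.
Proof.
  intros Hgrow Hle n Hn. apply Rnot_lt_le; intros Hpos.
  assert (Hk : forall k, 8 ^ k * e n <= e (n + k)%nat).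
  { intros k; induction k as [|k IH]; [rewrite Nat.add_0_r; simpl; lra|].
    rewrite Nat.add_succ_r. specialize (Hgrow (n + k)%nat ltac:(lia)).
    simpl; lra. }
  (* [32 / 27] is the quotient of 8 and [27 / 4]; [K] is chosen so that its power beats the ratio of
     the upper bound to [e n]. *)
  destruct (Pow_x_infinity (32 / 27)) with (b := (M * (27 / 4) ^ n + 1) / e n)
    as [K HK]; [rewrite Rabs_pos_eq; lra|].
  specialize (HK K (le_n K)). rewrite Rabs_pos_eq in HK by (apply pow_le; lra).
  specialize (Hk K). specialize (Hle (n + K)%nat ltac:(lia)).
  rewrite pow_add in Hle.
  assert (HP : 0 < (27 / 4) ^ K) by (apply pow_lt; lra).
  replace 8 with (32 / 27 * (27 / 4)) in Hk by field.
  rewrite Rpow_mult_distr in Hk.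
  assert (H1 : (M * (27 / 4) ^ n + 1) <= (32 / 27) ^ K * e n).
  { replace (M * (27 / 4) ^ n + 1) with ((M * (27 / 4) ^ n + 1) / e n * e n)
      by (field; lra).
    apply Rmult_le_compat_r; lra. }
  nra.
Qed.

(* The defect of [u] in the recurrence for [returns_coef (3 n + 2) n / top_binom n],
   with [x = n], [u = u (n)] and [u' = u (n + 1)]. *)
Definition rate_step (x u u' : R) : R :=
  8 * (x + 1) / (x + 4) - (5 * x + 6) / (2 * (2 * x + 3))
  - (x + 2) / (x + 5) * (3 * (3 * x + 5) * (3 * x + 4) / ((2 * x + 4) * (2 * x + 3)))
  + 8 * u / (x + 4)
  - u' / (x + 5) * (3 * (3 * x + 5) * (3 * x + 4) / ((2 * x + 4) * (2 * x + 3))).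

(** The error of a candidate [u] obeys the recurrence with factor 8 and the defect as source term;
    the sign of the defect is what [growth_nonpos] needs. *)
Lemma returns_rate_sub_S (u : R -> R) n :
  returns_rate (S n) - u (INR n + 1) / (INR n + 5) * top_binom (S n) =
  8 * (returns_rate n - u (INR n) / (INR n + 4) * top_binom n)
  + rate_step (INR n) (u (INR n)) (u (INR n + 1)) * top_binom n.
Proof.
  rewrite returns_rate_S, top_binom_S. unfold rate_step.
  pose proof (pos_INR n). field; lra.
Qed.

(** For polynomials with nonnegative coefficients in a nonnegative variable. The substitution
    [y = x - 1] brings the numerators of the rational inequalities for [x >= 1] into this form. *)
Ltac pos_poly :=
  repeat first
    [ apply Rplus_le_le_0_compat | apply Rmult_le_pos | apply pow_le | lra ].
(* Truncations of [18 / x * (1 - 56 / (3 x) + ...)]; the constant 9000 exceeds the true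
   coefficient enough for [upper_ratio] to be a supersolution from [x = 1] on. *)
Definition lower_ratio (x : R) : R := (18 * x - 336) / x ^ 2.
Definition upper_ratio (x : R) : R := (18 * x ^ 2 - 336 * x + 9000) / x ^ 3.

Lemma rate_step_lower_ratio x : 1 <= x ->
  rate_step x (lower_ratio x) (lower_ratio (x + 1)) <= 0.
Proof.
  intros Hx. unfold rate_step, lower_ratio.
  set (y := x - 1). replace x with (y + 1) by (unfold y; ring).
  assert (Hy : 0 <= y) by (unfold y; lra). clearbody y; clear x Hx.
  match goal with |- ?t <= 0 => replace t with
    (- ((76920 * y ^ 4 + 827256 * y ^ 3 + 3196920 * y ^ 2 + 5288424 * y + 3164400)
      / (2 * (y + 5) * (y + 6) * (2 * y + 5) * (2 * y + 6) * (y + 1) ^ 2 * (y + 2) ^ 2)))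
    by (field; lra) end.
  apply Ropp_le_cancel; rewrite Ropp_0, Ropp_involutive.
  apply Rmult_le_pos; [|apply Rlt_le, Rinv_0_lt_compat]; [pos_poly|].
  repeat apply Rmult_lt_0_compat; try apply pow_lt; lra.
Qed.

Lemma rate_step_upper_ratio x : 1 <= x ->
  0 <= rate_step x (upper_ratio x) (upper_ratio (x + 1)).
Proof.
  intros Hx. unfold rate_step, upper_ratio.
  set (y := x - 1). replace x with (y + 1) by (unfold y; ring).
  assert (Hy : 0 <= y) by (unfold y; lra). clearbody y; clear x Hx.
  match goal with |- 0 <= ?t => replace t with
    ((13080 * y ^ 6 + 2703984 * y ^ 5 + 32939472 * y ^ 4 + 157742304 * y ^ 3
      + 367282488 * y ^ 2 + 417059952 * y + 185911200)
      / (2 * (y + 5) * (y + 6) * (2 * y + 5) * (2 * y + 6) * (y + 1) ^ 3 * (y + 2) ^ 3))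
    by (field; lra) end.
  apply Rmult_le_pos; [|apply Rlt_le, Rinv_0_lt_compat]; [pos_poly|].
  repeat apply Rmult_lt_0_compat; try apply pow_lt; lra.
Qed.

Lemma A11_rate n : INR (A11 n) = (INR n + 4) * returns_rate n.
Proof.
  rewrite A11_returns_coef; unfold returns_rate. pose proof (pos_INR n); field; lra.
Qed.

Lemma A11_le n : (1 <= n)%nat -> INR (A11 n) <= upper_ratio (INR n) * top_binom n.
Proof.
  intros Hn.
  assert (H : returns_rate n - upper_ratio (INR n) / (INR n + 4) * top_binom n <= 0).
  (* Both subtracted terms are nonnegative, so half of the constant [9 / 4] of [binom_sum_top_le]
     suffices. *)
  { revert n Hn. apply growth_nonpos with (9 / 8).
    - intros n Hn. apply le_INR in Hn; simpl in Hn.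
      rewrite S_INR; replace (INR n + 1 + 4) with (INR n + 5) by ring.
      rewrite returns_rate_sub_S.
      pose proof (rate_step_upper_ratio _ Hn). pose proof (top_binom_pos n). nra.
    - intros n Hn. apply le_INR in Hn; simpl in Hn.
      rewrite returns_rate_binom_sum.
      pose proof (binom_sum_top_le n). pose proof (top_binom_pos n).
      assert (0 <= (INR n + 1) / (INR n + 4) * top_binom n).
      { repeat apply Rmult_le_pos; try apply Rlt_le, Rinv_0_lt_compat; lra. }
      assert (0 <= upper_ratio (INR n) / (INR n + 4) * top_binom n).
      { unfold upper_ratio.
        repeat apply Rmult_le_pos; try apply Rlt_le, Rinv_0_lt_compat;
          try apply pow_lt; nra. }
      lra. }
  apply le_INR in Hn; simpl in Hn. rewrite A11_rate.
  apply (Rmult_le_compat_l (INR n + 4)) in H; [|lra].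
  apply Rminus_le.
  replace (upper_ratio (INR n)) with
    ((INR n + 4) * (upper_ratio (INR n) / (INR n + 4))) by (field; lra).
  lra.
Qed.

Lemma A11_ge n : (1 <= n)%nat -> lower_ratio (INR n) * top_binom n <= INR (A11 n).
Proof.
  intros Hn.
  assert (H : lower_ratio (INR n) / (INR n + 4) * top_binom n - returns_rate n <= 0).
  (* [81 / 2 = 18 * (9 / 4)]: the ratio is at most 18, [top_binom] is bounded by the partial sum,
     and [returns_rate] is nonnegative because it comes from a count. *)
  { revert n Hn. apply growth_nonpos with (81 / 2).
    - intros n Hn. apply le_INR in Hn; simpl in Hn.
      rewrite S_INR; replace (INR n + 1 + 4) with (INR n + 5) by ring.
      pose proof (returns_rate_sub_S lower_ratio n).
      pose proof (rate_step_lower_ratio _ Hn). pose proof (top_binom_pos n). nra.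
    - intros n Hn. apply le_INR in Hn; simpl in Hn.
      assert (Hr : 0 <= returns_rate n).
      { pose proof (pos_INR (A11 n)) as H. rewrite A11_rate in H. nra. }
      pose proof (binom_sum_top_le n). pose proof (top_binom_pos n) as Hp.
      pose proof (binom_le_sum (3 * n + 2) n) as Hb; fold (top_binom n) in Hb.
      assert (Hl : lower_ratio (INR n) / (INR n + 4) <= 18).
      { apply Rminus_le. unfold lower_ratio.
        replace ((18 * INR n - 336) / INR n ^ 2 / (INR n + 4) - 18) with
          (- ((18 * INR n ^ 2 * (INR n + 4) - 18 * INR n + 336)
              / (INR n ^ 2 * (INR n + 4)))) by (field; lra).
        apply Ropp_le_cancel; rewrite Ropp_0, Ropp_involutive.
        apply Rmult_le_pos; [nra|]. apply Rlt_le, Rinv_0_lt_compat.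
        apply Rmult_lt_0_compat; [apply pow_lt|]; lra. }
      apply (Rmult_le_compat_r (top_binom n)) in Hl; lra. }
  apply le_INR in Hn; simpl in Hn. rewrite A11_rate.
  apply (Rmult_le_compat_l (INR n + 4)) in H; [|lra].
  apply Rminus_le.
  replace (lower_ratio (INR n)) with
    ((INR n + 4) * (lower_ratio (INR n) / (INR n + 4))) by (field; lra).
  lra.
Qed.

(** * Logarithm bounds and convergence in Stirling's formula *)

Lemma nonneg_of_is_derive (f df : R -> R) :
  (forall x, 0 <= x -> is_derive f x (df x)) ->
  (forall x, 0 <= x -> 0 <= df x) -> f 0 = 0 ->
  forall x, 0 <= x -> 0 <= f x.
Proof.
  intros Hd Hpos H0 x Hx.
  destruct (MVT_gen f 0 x df) as [c [Hc E]].
  - intros t Ht. rewrite Rmin_left, Rmax_right in Ht by lra. apply Hd; lra.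
  - intros t Ht. rewrite Rmin_left, Rmax_right in Ht by lra.
    apply continuity_pt_filterlim, (ex_derive_continuous f).
    exists (df t); apply Hd; lra.
  - rewrite Rmin_left, Rmax_right in Hc by lra.
    pose proof (Hpos c ltac:(lra)). nra.
Qed.

(** The midpoint rule for the convex function [1 / t] on [[1, 1 + x]]. *)
Lemma ln_1p_ge x : 0 <= x -> 2 * x / (2 + x) <= ln (1 + x).
Proof.
  intros Hx. apply Rminus_le_0. revert x Hx.
  apply nonneg_of_is_derive with (fun x => x ^ 2 / ((1 + x) * (2 + x) ^ 2)).
  - intros x Hx. auto_derive; [repeat split; lra|]. field; lra.
  - intros x Hx. apply Rmult_le_pos; [nra|]. apply Rlt_le, Rinv_0_lt_compat; nra.
  - replace (1 + 0) with 1 by ring; rewrite ln_1; field.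
Qed.

(** The trapezoidal rule for the same integral. *)
Lemma ln_1p_le x : 0 <= x -> ln (1 + x) <= x * (2 + x) / (2 * (1 + x)).
Proof.
  intros Hx. apply Rminus_le_0. revert x Hx.
  apply nonneg_of_is_derive with (fun x => x ^ 2 / (2 * (1 + x) ^ 2)).
  - intros x Hx. auto_derive; [repeat split; lra|]. field; lra.
  - intros x Hx. apply Rmult_le_pos; [nra|]. apply Rlt_le, Rinv_0_lt_compat; nra.
  - replace (1 + 0) with 1 by ring; rewrite ln_1; field.
Qed.

Definition stirling_log (n : nat) : R :=
  ln (INR (fact n)) - (INR n + 1 / 2) * ln (INR n) + INR n.

(** The decrement is [(n + 1/2) ln (1 + 1/n) - 1], estimated by the two quadrature rules at
    [x = 1/n]. The upper bound telescopes, so the decreasing sequence is bounded below. *)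
Lemma stirling_log_S n : (1 <= n)%nat ->
  0 <= stirling_log n - stirling_log (S n) <= / 4 * (/ INR n - / INR (S n)).
Proof.
  intros Hn. apply le_INR in Hn; simpl (INR 1) in Hn.
  unfold stirling_log.
  change (fact (S n)) with (S n * fact n)%nat.
  rewrite mult_INR, S_INR. set (x := INR n) in *.
  rewrite ln_mult by (try lra; apply INR_fact_lt_0).
  assert (E : ln (x + 1) = ln x + ln (1 + / x)).
  { rewrite <- ln_mult; [f_equal; field; lra|lra|].
    pose proof (Rinv_0_lt_compat x). lra. }
  rewrite E.
  assert (Hi : 0 < / x) by (apply Rinv_0_lt_compat; lra).
  pose proof (ln_1p_ge (/ x) ltac:(lra)) as H1.
  pose proof (ln_1p_le (/ x) ltac:(lra)) as H2.
  replace (2 * / x / (2 + / x)) with (1 / (x + 1 / 2)) in H1 by (field; lra).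
  replace (/ x * (2 + / x) / (2 * (1 + / x)))
    with ((x + 1 / 2) / (x * (x + 1))) in H2 by (field; lra).
  set (L := ln (1 + / x)) in *.
  apply (Rmult_le_compat_l (x + 1 / 2)) in H1; [|lra].
  apply (Rmult_le_compat_l (x + 1 / 2)) in H2; [|lra].
  replace ((x + 1 / 2) * (1 / (x + 1 / 2))) with 1 in H1 by (field; lra).
  replace ((x + 1 / 2) * ((x + 1 / 2) / (x * (x + 1))))
    with (1 + / 4 * (/ x - / (x + 1))) in H2 by (field; lra).
  lra.
Qed.

Lemma stirling_log_cv : exists F : R, is_lim_seq stirling_log F.
Proof.
  assert (Hd : forall n, stirling_log (S (S n)) <= stirling_log (S n)).
  { intros n. pose proof (stirling_log_S (S n) ltac:(lia)). lra. }
  assert (Hb : forall n, stirling_log 1 - / 4 + / 4 * / INR (S n) <= stirling_log (S n)).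
  { intros n; induction n as [|n IH].
    - simpl INR. lra.
    - pose proof (stirling_log_S (S n) ltac:(lia)). lra. }
  destruct (ex_finite_lim_seq_decr (fun n => stirling_log (S n)) (stirling_log 1 - / 4))
    as [F HF].
  - exact Hd.
  - intros n. specialize (Hb n).
    pose proof (Rinv_0_lt_compat (INR (S n)) (lt_0_INR _ (Nat.lt_0_succ n))). lra.
  - exists F. apply is_lim_seq_incr_1, HF.
Qed.

(** * Wallis integrals *)

Definition wallis (n : nat) : R := RInt (fun x => sin x ^ n) 0 (PI / 2).

Lemma ex_RInt_sin_pow n a b : ex_RInt (fun x => sin x ^ n) a b.
Proof.
  apply (ex_RInt_continuous (V := R_CompleteNormedModule)).
  intros x _. apply (ex_derive_continuous (fun x => sin x ^ n)).
  auto_derive; trivial.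
Qed.

Lemma wallis_0 : wallis 0 = PI / 2.
Proof.
  unfold wallis; simpl. rewrite RInt_const. unfold scal; simpl; unfold mult; simpl; lra.
Qed.

Lemma wallis_1 : wallis 1 = 1.
Proof.
  apply is_RInt_unique.
  apply is_RInt_ext with (fun x => sin x); [intros; simpl; ring|].
  replace 1 with (minus (- cos (PI / 2)) (- cos 0)).
  - apply (is_RInt_derive (fun x => - cos x)).
    + intros x _. auto_derive; [trivial|ring].
    + intros x _. apply (ex_derive_continuous sin). auto_derive; trivial.
  - rewrite cos_PI2, cos_0; unfold minus, plus, opp; simpl; ring.
Qed.

(** The difference of the integrands is the derivative of [- cos x * sin x ^ (n + 1)], which
    vanishes at both ends. *)
Lemma wallis_SS n : (INR n + 2) * wallis (S (S n)) = (INR n + 1) * wallis n.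
Proof.
  assert (H : is_RInt (fun x => (INR n + 2) * sin x ^ S (S n) - (INR n + 1) * sin x ^ n)
                0 (PI / 2)
                (minus (- cos (PI / 2) * sin (PI / 2) ^ S n) (- cos 0 * sin 0 ^ S n))).
  { apply (is_RInt_derive (fun x => - cos x * sin x ^ S n)).
    - intros x _. auto_derive; [trivial|].
      change (match n with O => 1 | S _ => INR n + 1 end) with (INR (S n)).
      rewrite S_INR. simpl Nat.pred.
      pose proof (sin2_cos2 x) as E. unfold Rsqr in E.
      simpl pow.
      transitivity (sin x * sin x * sin x ^ n
        - (INR n + 1) * sin x ^ n * (cos x * cos x)); [ring|].
      replace (cos x * cos x) with (1 - sin x * sin x) by lra. ring.
    - intros x _. apply (ex_derive_continuous
        (fun x => (INR n + 2) * sin x ^ S (S n) - (INR n + 1) * sin x ^ n)).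
      auto_derive; trivial. }
  apply (is_RInt_unique (V := R_CompleteNormedModule)) in H.
  rewrite cos_PI2, sin_0 in H.
  unfold minus, plus, opp in H; simpl in H.
  assert (H' : is_RInt (fun x => (INR n + 2) * sin x ^ S (S n) - (INR n + 1) * sin x ^ n)
                 0 (PI / 2) ((INR n + 2) * wallis (S (S n)) - (INR n + 1) * wallis n)).
  { apply (is_RInt_minus (V := R_NormedModule));
      apply (is_RInt_scal (V := R_NormedModule));
      apply (RInt_correct (V := R_CompleteNormedModule)), ex_RInt_sin_pow. }
  apply (is_RInt_unique (V := R_CompleteNormedModule)) in H'.
  simpl in H'. rewrite H in H'. lra.
Qed.

Lemma wallis_pos n : 0 < wallis n.
Proof.
  enough (0 < wallis n /\ 0 < wallis (S n)) by tauto.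
  induction n as [|n [IH1 IH2]].
  - rewrite wallis_0, wallis_1. pose proof PI_RGT_0; lra.
  - split; [exact IH2|]. pose proof (wallis_SS n). pose proof (pos_INR n). nra.
Qed.

Lemma wallis_decr n : wallis (S n) <= wallis n.
Proof.
  unfold wallis. pose proof PI_RGT_0.
  apply RInt_le; try apply ex_RInt_sin_pow; [lra|].
  intros x Hx. simpl.
  assert (0 <= sin x) by (apply sin_ge_0; lra).
  pose proof (SIN_bound x). pose proof (pow_le (sin x) n ltac:(assumption)). nra.
Qed.

Lemma wallis_mul_S n : (INR n + 1) * wallis n * wallis (S n) = PI / 2.
Proof.
  induction n as [|n IH].
  - rewrite wallis_0, wallis_1; simpl; ring.
  - rewrite S_INR, <- IH. pose proof (wallis_SS n).
    transitivity (((INR n + 2) * wallis (S (S n))) * wallis (S n)); [ring|].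
    rewrite H; ring.
Qed.

(** Monotonicity replaces a neighbouring integral in the constant product [wallis_mul_S] by
    [wallis n], once from each side. *)
Lemma wallis_sqr_bounds n : (1 <= n)%nat ->
  PI / 2 / (INR n + 1) <= wallis n ^ 2 <= PI / 2 / INR n.
Proof.
  intros Hn. destruct n as [|n]; [lia|]. clear Hn.
  pose proof (pos_INR n).
  pose proof (wallis_pos n); pose proof (wallis_pos (S n)).
  split.
  - apply (Rmult_le_reg_l (INR (S n) + 1)); [rewrite S_INR; lra|].
    replace ((INR (S n) + 1) * (PI / 2 / (INR (S n) + 1))) with (PI / 2)
      by (field; rewrite S_INR; lra).
    pose proof (wallis_mul_S (S n)) as <-. pose proof (wallis_decr (S n)).
    replace ((INR (S n) + 1) * wallis (S n) ^ 2)
      with ((INR (S n) + 1) * wallis (S n) * wallis (S n)) by ring.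
    apply Rmult_le_compat_l; [|assumption].
    apply Rmult_le_pos; [rewrite S_INR|]; lra.
  - apply (Rmult_le_reg_l (INR (S n))); [rewrite S_INR; lra|].
    replace (INR (S n) * (PI / 2 / INR (S n))) with (PI / 2)
      by (field; rewrite S_INR; lra).
    pose proof (wallis_mul_S n) as <-. pose proof (wallis_decr n).
    rewrite S_INR.
    replace ((INR n + 1) * wallis (S n) ^ 2)
      with ((INR n + 1) * wallis (S n) * wallis (S n)) by ring.
    apply Rmult_le_compat_r; [lra|].
    apply Rmult_le_compat_l; lra.
Qed.

Lemma wallis_even n :
  wallis (2 * n) = PI / 2 * (INR (fact (2 * n)) / (4 ^ n * INR (fact n) ^ 2)).
Proof.
  induction n as [|n IH].
  - simpl (2 * 0)%nat. rewrite wallis_0; simpl; field.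
  - replace (2 * S n)%nat with (S (S (2 * n))) by lia.
    pose proof (wallis_SS (2 * n)) as H. rewrite IH in H.
    change (fact (S (S (2 * n)))) with (S (S (2 * n)) * (S (2 * n) * fact (2 * n)))%nat.
    change (fact (S n)) with (S n * fact n)%nat.
    assert (E : INR (2 * n) = 2 * INR n) by (rewrite mult_INR; simpl; ring).
    rewrite !mult_INR, !S_INR, E. rewrite E in H.
    pose proof (pos_INR n).
    apply Rmult_eq_reg_l with (2 * INR n + 2); [|lra].
    rewrite H. simpl pow. field.
    repeat split; try lra; try apply INR_fact_neq_0. apply pow_nonzero; lra.
Qed.

(** * The constant in Stirling's formula *)

Lemma is_lim_seq_mul_index (u : nat -> R) (l : R) (k : nat) : (1 <= k)%nat ->
  is_lim_seq u l -> is_lim_seq (fun n => u (k * n)%nat) l.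
Proof.
  intros Hk Hu. apply (is_lim_seq_subseq u l (fun n => (k * n)%nat)); [|exact Hu].
  apply eventually_subseq; intros n; nia.
Qed.

Lemma is_lim_seq_inv_INR : is_lim_seq (fun n => / INR n) 0.
Proof.
  replace (Finite 0) with (Rbar_inv p_infty) by reflexivity.
  apply is_lim_seq_inv; [apply is_lim_seq_INR|discriminate].
Qed.

Lemma is_lim_seq_comp_derive (f : R -> R) (u : nat -> R) (l : R) :
  ex_derive f l -> is_lim_seq u l -> is_lim_seq (fun n => f (u n)) (f l).
Proof.
  intros Hf Hu. apply is_lim_seq_continuous; [|exact Hu].
  apply continuity_pt_filterlim, (ex_derive_continuous f), Hf.
Qed.

Lemma ln_fact n :
  ln (INR (fact n)) = stirling_log n + (INR n + 1 / 2) * ln (INR n) - INR n.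
Proof. unfold stirling_log; ring. Qed.

Lemma ln_mult_INR k n : (1 <= k)%nat -> (1 <= n)%nat ->
  ln (INR (k * n)) = ln (INR k) + ln (INR n).
Proof. intros; rewrite mult_INR; apply ln_mult; apply lt_0_INR; lia. Qed.

(** The left side is [n (C(2n, n) / 4^n)^2]; in its logarithm everything cancels except the
    [stirling_log] terms and [ln 2]. *)
Lemma wallis_stirling n : (1 <= n)%nat ->
  INR n * (2 / PI * wallis (2 * n)) ^ 2 =
  exp (2 * stirling_log (2 * n) - 4 * stirling_log n + ln 2).
Proof.
  intros Hn. pose proof (lt_0_INR n Hn) as Hx. pose proof PI_RGT_0.
  pose proof (INR_fact_lt_0 n) as Hf1. pose proof (INR_fact_lt_0 (2 * n)) as Hf2.
  assert (H4 : 0 < 4 ^ n) by (apply pow_lt; lra).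
  rewrite wallis_even.
  replace (2 / PI * (PI / 2 * (INR (fact (2 * n)) / (4 ^ n * INR (fact n) ^ 2))))
    with (INR (fact (2 * n)) / (4 ^ n * INR (fact n) ^ 2)) by (field; repeat split; lra).
  assert (0 < 4 ^ n * INR (fact n) ^ 2)
    by (apply Rmult_lt_0_compat; [|apply pow_lt]; assumption).
  assert (0 < INR (fact (2 * n)) / (4 ^ n * INR (fact n) ^ 2))
    by (apply Rdiv_lt_0_compat; assumption).
  rewrite <- (exp_ln (INR n * _))
    by (apply Rmult_lt_0_compat; [|apply pow_lt]; assumption).
  f_equal.
  rewrite ln_mult, ln_pow, ln_div, ln_mult, !ln_pow, !ln_fact;
    try assumption; try (apply pow_lt; assumption); try lra.
  replace 4 with (2 * 2) at 1 by ring. rewrite (ln_mult 2 2) by lra.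
  rewrite ln_mult_INR, mult_INR by lia. simpl (INR 2).
  replace (1 + 1) with 2 by ring. field.
Qed.

(** One sequence has the limit [exp (ln 2 - 2 F)] by the convergence of [stirling_log] and the limit
    [1 / PI] by Wallis; equating them determines [F]. *)
Lemma stirling_log_lim : is_lim_seq stirling_log (ln (2 * PI) / 2).
Proof.
  destruct stirling_log_cv as [F HF]. pose proof PI_RGT_0.
  assert (H1 : is_lim_seq (fun n => INR n * (2 / PI * wallis (2 * n)) ^ 2)
                 (exp (2 * F - 4 * F + ln 2))).
  { apply is_lim_seq_ext_loc with
      (fun n => exp (2 * stirling_log (2 * n) - 4 * stirling_log n + ln 2)).
    - exists 1%nat; intros n Hn; symmetry; apply wallis_stirling, Hn.
    - apply (is_lim_seq_comp_derive exp); [auto_derive; trivial|].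
      apply is_lim_seq_plus'; [|apply is_lim_seq_const].
      apply is_lim_seq_minus'; apply (is_lim_seq_scal_l _ _ (Finite F)).
      + apply is_lim_seq_mul_index; [lia|exact HF].
      + exact HF. }
  assert (H2 : is_lim_seq (fun n => INR n * (2 / PI * wallis (2 * n)) ^ 2) (1 / PI)).
  { apply is_lim_seq_le_le_loc with (fun n => 1 / PI * (2 / (2 + / INR n)))
      (fun _ => 1 / PI).
    - exists 1%nat; intros n Hn. pose proof (lt_0_INR n Hn) as Hx.
      destruct (wallis_sqr_bounds (2 * n) ltac:(lia)) as [B1 B2].
      rewrite mult_INR in B1, B2; simpl (INR 2) in B1, B2.
      replace (INR n * (2 / PI * wallis (2 * n)) ^ 2)
        with (4 * INR n / PI ^ 2 * wallis (2 * n) ^ 2) by (field; lra).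
      assert (0 <= 4 * INR n / PI ^ 2).
      { apply Rmult_le_pos; [lra|]. apply Rlt_le, Rinv_0_lt_compat, pow_lt; lra. }
      apply (Rmult_le_compat_l (4 * INR n / PI ^ 2)) in B1; [|assumption].
      apply (Rmult_le_compat_l (4 * INR n / PI ^ 2)) in B2; [|assumption].
      split.
      + eapply Rle_trans; [|exact B1]. right; field; repeat split; lra.
      + eapply Rle_trans; [exact B2|]. right; field; repeat split; lra.
    - replace (Finite (1 / PI)) with (Finite (1 / PI * (2 / (2 + 0)))) by (f_equal; field; lra).
      apply (is_lim_seq_comp_derive (fun y => 1 / PI * (2 / (2 + y))));
        [auto_derive; lra|apply is_lim_seq_inv_INR].
    - apply is_lim_seq_const. }
  apply is_lim_seq_unique in H1. apply is_lim_seq_unique in H2.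
  rewrite H1 in H2. injection H2 as E.
  apply (f_equal ln) in E. rewrite ln_exp, ln_div, ln_1 in E by lra.
  replace (ln (2 * PI) / 2) with F; [exact HF|].
  rewrite ln_mult by lra. lra.
Qed.

(** * The limit of the normalised binomial coefficient *)

Lemma top_binom_fact n :
  top_binom n = INR (fact (3 * n)) / (INR (fact n) * INR (fact (2 * n)))
    * ((3 * INR n + 2) * (3 * INR n + 1) / ((2 * INR n + 2) * (2 * INR n + 1))).
Proof.
  unfold top_binom. replace (3 * n + 2)%nat with (n + (2 * n + 2))%nat by lia.
  rewrite binom_fact. replace (n + (2 * n + 2))%nat with (S (S (3 * n))) by lia.
  replace (2 * n + 2)%nat with (S (S (2 * n))) by lia.
  change (fact (S (S (3 * n)))) with (S (S (3 * n)) * (S (3 * n) * fact (3 * n)))%nat.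
  change (fact (S (S (2 * n)))) with (S (S (2 * n)) * (S (2 * n) * fact (2 * n)))%nat.
  rewrite !(mult_INR (S _)), !S_INR, !(mult_INR _ n); simpl (INR 2); simpl (INR 3).
  pose proof (pos_INR n).
  field; repeat split; try lra; apply INR_fact_neq_0.
Qed.

(* Squaring avoids the square roots of the binomial asymptotics. *)
Definition top_binom_sqr (n : nat) : R := top_binom n ^ 2 * INR n * (16 / 729) ^ n.

(** [16 / 729 = (4 / 27)^2] removes the exponential growth; the squared square-root factors give
    [n * 3n / (n * 2n) = 3 / 2]. *)
Lemma trinomial_stirling n : (1 <= n)%nat ->
  (INR (fact (3 * n)) / (INR (fact n) * INR (fact (2 * n)))) ^ 2
    * INR n * (16 / 729) ^ n =
  exp (2 * (stirling_log (3 * n) - stirling_log n - stirling_log (2 * n)) + ln (3 / 2)).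
Proof.
  intros Hn. pose proof (lt_0_INR n Hn) as Hx.
  pose proof (INR_fact_lt_0 n) as Hf1. pose proof (INR_fact_lt_0 (2 * n)) as Hf2.
  pose proof (INR_fact_lt_0 (3 * n)) as Hf3.
  assert (0 < INR (fact n) * INR (fact (2 * n)))
    by (apply Rmult_lt_0_compat; assumption).
  assert (0 < INR (fact (3 * n)) / (INR (fact n) * INR (fact (2 * n))))
    by (apply Rdiv_lt_0_compat; assumption).
  assert (0 < (INR (fact (3 * n)) / (INR (fact n) * INR (fact (2 * n)))) ^ 2)
    by (apply pow_lt; assumption).
  assert (0 < (16 / 729) ^ n) by (apply pow_lt; lra).
  rewrite <- (exp_ln (_ * _ * (16 / 729) ^ n))
    by (apply Rmult_lt_0_compat; [apply Rmult_lt_0_compat|]; assumption).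
  f_equal.
  rewrite !ln_mult, !ln_pow, !ln_div, !ln_mult, !ln_fact;
    try assumption; try lra; try (apply Rmult_lt_0_compat; assumption).
  replace 16 with (2 ^ 4) by ring. replace 729 with (3 ^ 6) by ring.
  rewrite !ln_pow by lra.
  rewrite !ln_mult_INR, !mult_INR by lia. simpl INR.
  replace (1 + 1) with 2 by ring. replace (2 + 1) with 3 by ring. field.
Qed.

Lemma top_binom_sqr_lim : is_lim_seq top_binom_sqr (243 / (64 * PI)).
Proof.
  pose proof PI_RGT_0.
  (* The square of the rational factor in [top_binom_fact], in the variable [y = 1 / n]. *)
  set (q := fun y => ((3 + 2 * y) * (3 + y) / ((2 + 2 * y) * (2 + y))) ^ 2).
  apply is_lim_seq_ext_loc with (fun n =>
    exp (2 * (stirling_log (3 * n) - stirling_log n - stirling_log (2 * n)) + ln (3 / 2))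
    * q (/ INR n)).
  - exists 1%nat; intros n Hn. rewrite <- trinomial_stirling by assumption.
    unfold top_binom_sqr, q; rewrite top_binom_fact.
    pose proof (lt_0_INR n Hn).
    pose proof (INR_fact_neq_0 n). pose proof (INR_fact_neq_0 (2 * n)).
    field; repeat split; try assumption; lra.
  - pose proof stirling_log_lim as HF. set (F := ln (2 * PI) / 2) in HF.
    replace (243 / (64 * PI)) with (exp (2 * (F - F - F) + ln (3 / 2)) * q 0).
    + apply is_lim_seq_mult'.
      * apply (is_lim_seq_comp_derive exp); [auto_derive; trivial|].
        apply is_lim_seq_plus'; [|apply is_lim_seq_const].
        apply (is_lim_seq_scal_l _ _ (Finite (F - F - F))).
        apply is_lim_seq_minus'; [apply is_lim_seq_minus'|];
          try (apply is_lim_seq_mul_index; [lia|]); exact HF.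
      * apply is_lim_seq_comp_derive; [|apply is_lim_seq_inv_INR].
        unfold q; auto_derive; lra.
    + replace (2 * (F - F - F) + ln (3 / 2)) with (ln (3 / 2) - ln (2 * PI))
        by (unfold F; field).
      rewrite <- ln_div, exp_ln by (try apply Rdiv_lt_0_compat; lra).
      unfold q; field; lra.
Qed.

(** * Explicit bounds from monotone quotients *)

(** The relative expansion of [top_binom] begins [1 - 43 / (72 n) + 5449 / (10368 n^2)]. The last
    coefficient lies between 0 and [3 / 5], so the two truncations approach from opposite sides. *)
Definition lower_corr (x : R) : R := 1 - 43 / (72 * x).
Definition upper_corr (x : R) : R := 1 - 43 / (72 * x) + 3 / (5 * x ^ 2).

Definition sqr_step (x : R) : R :=
  (3 * (3 * x + 5) * (3 * x + 4) / ((2 * x + 4) * (2 * x + 3))) ^ 2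
    * (16 / 729) * ((x + 1) / x).

(** [sqr_step] is the quotient of successive [top_binom_sqr]. Hence [top_binom_sqr / lower_corr ^ 2]
    decreases and stays above its limit; with [upper_corr] it increases and stays below. *)
Lemma sqr_step_lower x : 1 <= x ->
  sqr_step x * lower_corr x ^ 2 <= lower_corr (x + 1) ^ 2.
Proof.
  intros Hx. apply Rminus_le_0. unfold sqr_step, lower_corr.
  set (y := x - 1). replace x with (y + 1) by (unfold y; ring).
  assert (Hy : 0 <= y) by (unfold y; lra). clearbody y; clear x Hx.
  match goal with |- 0 <= ?t => replace t with
    ((127114272 * y ^ 6 + 1495330308 * y ^ 5 + 7111709604 * y ^ 4
      + 17383585896 * y ^ 3 + 22789318680 * y ^ 2 + 14910347700 * y + 3654618948)
      / (729 * 72 ^ 2 * ((2 * y + 6) * (2 * y + 5)) ^ 2 * (y + 1) ^ 3 * (y + 2) ^ 2))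
    by (field; lra) end.
  apply Rmult_le_pos; [|apply Rlt_le, Rinv_0_lt_compat]; [pos_poly|].
  repeat apply Rmult_lt_0_compat; try apply pow_lt; try apply Rmult_lt_0_compat; lra.
Qed.

Lemma sqr_step_upper x : 1 <= x ->
  upper_corr (x + 1) ^ 2 <= sqr_step x * upper_corr x ^ 2.
Proof.
  intros Hx. apply Rminus_le_0. unfold sqr_step, upper_corr.
  set (y := x - 1). replace x with (y + 1) by (unfold y; ring).
  assert (Hy : 0 <= y) by (unfold y; lra). clearbody y; clear x Hx.
  match goal with |- 0 <= ?t => replace t with
    ((450113760 * y ^ 10 + 13211675100 * y ^ 9 + 148031339076 * y ^ 8
      + 898175847276 * y ^ 7 + 3370506933780 * y ^ 6 + 8309183545044 * y ^ 5
      + 13774707905724 * y ^ 4 + 15294522625956 * y ^ 3 + 10982628713628 * y ^ 2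
      + 4655603874240 * y + 897059947248)
      / (729 * 360 ^ 2 * ((2 * y + 6) * (2 * y + 5)) ^ 2 * (y + 1) ^ 5 * (y + 2) ^ 4))
    by (field; lra) end.
  apply Rmult_le_pos; [|apply Rlt_le, Rinv_0_lt_compat]; [pos_poly|].
  repeat apply Rmult_lt_0_compat; try apply pow_lt; try apply Rmult_lt_0_compat; lra.
Qed.

Lemma lower_corr_pos x : 1 <= x -> 0 < lower_corr x.
Proof.
  intros Hx. unfold lower_corr.
  replace (1 - 43 / (72 * x)) with ((72 * x - 43) / (72 * x)) by (field; lra).
  apply Rdiv_lt_0_compat; lra.
Qed.

Lemma upper_corr_pos x : 1 <= x -> 0 < upper_corr x.
Proof.
  intros Hx. pose proof (lower_corr_pos x Hx) as H. unfold upper_corr, lower_corr in *.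
  assert (0 < 3 / (5 * x ^ 2)); [|lra].
  apply Rdiv_lt_0_compat; [lra|]. apply Rmult_lt_0_compat; [|apply pow_lt]; lra.
Qed.

Lemma top_binom_sqr_pos n : (1 <= n)%nat -> 0 < top_binom_sqr n.
Proof.
  intros Hn. unfold top_binom_sqr. pose proof (top_binom_pos n). pose proof (lt_0_INR n Hn).
  repeat apply Rmult_lt_0_compat; try apply pow_lt; lra.
Qed.

(** The index is shifted to avoid the division by zero in the corrections at 0. *)
Lemma top_binom_sqr_div_lim (w : R -> R) :
  w = lower_corr \/ w = upper_corr ->
  is_lim_seq (fun n => top_binom_sqr (S n) / w (INR (S n)) ^ 2) (243 / (64 * PI)).
Proof.
  intros Hw. pose proof PI_RGT_0.
  assert (H1 : is_lim_seq (fun n => w (INR n)) 1).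
  { destruct Hw as [-> | ->].
    - apply is_lim_seq_ext_loc with (fun n => 1 - 43 / 72 * / INR n).
      + exists 1%nat; intros n Hn. unfold lower_corr. pose proof (lt_0_INR n Hn). field; lra.
      + replace (Finite 1) with (Finite (1 - 43 / 72 * 0)) by (f_equal; ring).
        apply (is_lim_seq_comp_derive (fun y => 1 - 43 / 72 * y));
          [auto_derive; trivial|apply is_lim_seq_inv_INR].
    - apply is_lim_seq_ext_loc with (fun n => 1 - 43 / 72 * / INR n + 3 / 5 * (/ INR n) ^ 2).
      + exists 1%nat; intros n Hn. unfold upper_corr. pose proof (lt_0_INR n Hn). field; lra.
      + replace (Finite 1) with (Finite (1 - 43 / 72 * 0 + 3 / 5 * 0 ^ 2))
          by (f_equal; ring).
        apply (is_lim_seq_comp_derive (fun y => 1 - 43 / 72 * y + 3 / 5 * y ^ 2));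
          [auto_derive; trivial|apply is_lim_seq_inv_INR]. }
  apply (is_lim_seq_incr_1 (fun n => top_binom_sqr n / w (INR n) ^ 2)).
  replace (243 / (64 * PI)) with (243 / (64 * PI) / 1 ^ 2) by (field; lra).
  apply is_lim_seq_div'; [apply top_binom_sqr_lim| |lra].
  apply (is_lim_seq_comp_derive (fun y => y ^ 2)); [auto_derive; trivial|exact H1].
Qed.

Lemma top_binom_sqr_S n : (1 <= n)%nat ->
  top_binom_sqr (S n) = sqr_step (INR n) * top_binom_sqr n.
Proof.
  intros Hn. pose proof (lt_0_INR n Hn).
  unfold top_binom_sqr, sqr_step. rewrite top_binom_S, S_INR. simpl pow. field. lra.
Qed.

Lemma top_binom_sqr_ge n : (1 <= n)%nat ->
  243 / (64 * PI) * lower_corr (INR n) ^ 2 <= top_binom_sqr n.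
Proof.
  intros Hn. destruct n as [|n]; [lia|]. clear Hn.
  assert (Hpos : forall n, 0 < lower_corr (INR (S n)) ^ 2).
  { intros k. apply pow_lt, lower_corr_pos. rewrite S_INR; pose proof (pos_INR k); lra. }
  apply (Rle_div_r _ _ _ (Hpos n)).
  revert n. apply (is_lim_seq_decr_compare _ _ (top_binom_sqr_div_lim _ (or_introl eq_refl))).
  intros n.
  apply (Rle_div_l _ _ _ (Hpos (S n))).
  rewrite top_binom_sqr_S by lia. set (m := S n).
  rewrite (S_INR m).
  assert (1 <= INR m) by (unfold m; rewrite S_INR; pose proof (pos_INR n); lra).
  pose proof (sqr_step_lower (INR m) ltac:(assumption)) as H1.
  pose proof (top_binom_sqr_pos m ltac:(lia)) as H2. pose proof (Hpos n) as H3; fold m in H3.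
  apply Rmult_le_reg_r with (lower_corr (INR m) ^ 2); [exact H3|].
  apply (Rmult_le_compat_l (top_binom_sqr m)) in H1; [|lra].
  replace (top_binom_sqr m / lower_corr (INR m) ^ 2 * lower_corr (INR m + 1) ^ 2
    * lower_corr (INR m) ^ 2) with (top_binom_sqr m * lower_corr (INR m + 1) ^ 2); [lra|].
  set (a := lower_corr (INR m) ^ 2) in *. field. lra.
Qed.

Lemma top_binom_sqr_le n : (1 <= n)%nat ->
  top_binom_sqr n <= 243 / (64 * PI) * upper_corr (INR n) ^ 2.
Proof.
  intros Hn. destruct n as [|n]; [lia|]. clear Hn.
  assert (Hpos : forall n, 0 < upper_corr (INR (S n)) ^ 2).
  { intros k. apply pow_lt, upper_corr_pos. rewrite S_INR; pose proof (pos_INR k); lra. }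
  apply (Rle_div_l _ _ _ (Hpos n)).
  revert n. apply (is_lim_seq_incr_compare _ _ (top_binom_sqr_div_lim _ (or_intror eq_refl))).
  intros n.
  apply (Rle_div_r _ _ _ (Hpos (S n))).
  rewrite (top_binom_sqr_S (S n)) by lia. set (m := S n).
  rewrite (S_INR m).
  assert (1 <= INR m) by (unfold m; rewrite S_INR; pose proof (pos_INR n); lra).
  pose proof (sqr_step_upper (INR m) ltac:(assumption)) as H1.
  pose proof (top_binom_sqr_pos m ltac:(lia)) as H2. pose proof (Hpos n) as H3; fold m in H3.
  apply Rmult_le_reg_r with (upper_corr (INR m) ^ 2); [exact H3|].
  apply (Rmult_le_compat_l (top_binom_sqr m)) in H1; [|lra].
  replace (top_binom_sqr m / upper_corr (INR m) ^ 2 * upper_corr (INR m + 1) ^ 2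
    * upper_corr (INR m) ^ 2) with (top_binom_sqr m * upper_corr (INR m + 1) ^ 2); [lra|].
  set (a := upper_corr (INR m) ^ 2) in *. field. lra.
Qed.

(** * The main term and the final estimates *)

Lemma Rpower_half_odd x k : 0 < x -> Rpower x (INR k + 1 / 2) = x ^ k * sqrt x.
Proof.
  intros Hx. rewrite Rpower_plus, Rpower_pow by assumption.
  replace (1 / 2) with (/ 2) by field. rewrite Rpower_sqrt by assumption. reflexivity.
Qed.

Definition main_term (n : nat) : R :=
  243 * (27 / 4) ^ n / (4 * sqrt (3 * PI) * (INR n * sqrt (INR n))).

Lemma main_term_pos n : (1 <= n)%nat -> 0 < main_term n.
Proof.
  intros Hn. pose proof (lt_0_INR n Hn). pose proof PI_RGT_0.
  unfold main_term.
  apply Rdiv_lt_0_compat; repeat apply Rmult_lt_0_compat; try apply pow_lt;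
    try apply sqrt_lt_R0; lra.
Qed.

(** [main_term n * n / 18] is the leading term of [top_binom n]: its square is [243 / (64 PI n)]
    times [(729 / 16)^n]. *)
Lemma top_binom_main_term_sqr n : (1 <= n)%nat ->
  top_binom n ^ 2 =
  top_binom_sqr n * (64 * PI / 243) * (main_term n * INR n / 18) ^ 2.
Proof.
  intros Hn. pose proof (lt_0_INR n Hn). pose proof PI_RGT_0.
  assert (Hs : sqrt (3 * PI) ^ 2 = 3 * PI) by (rewrite <- Rsqr_pow2; apply Rsqr_sqrt; lra).
  assert (Hx : sqrt (INR n) ^ 2 = INR n) by (rewrite <- Rsqr_pow2; apply Rsqr_sqrt; lra).
  assert (0 < sqrt (3 * PI)) by (apply sqrt_lt_R0; lra).
  assert (0 < sqrt (INR n)) by (apply sqrt_lt_R0; lra).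
  assert (Hp : (16 / 729) ^ n * ((27 / 4) ^ n * (27 / 4) ^ n) = 1).
  { rewrite <- !Rpow_mult_distr.
    replace (16 / 729 * (27 / 4 * (27 / 4))) with 1 by field. apply pow1. }
  unfold top_binom_sqr, main_term.
  replace (top_binom n ^ 2 * INR n * (16 / 729) ^ n * (64 * PI / 243)
    * (243 * (27 / 4) ^ n / (4 * sqrt (3 * PI) * (INR n * sqrt (INR n))) * INR n / 18) ^ 2)
    with (top_binom n ^ 2 * ((16 / 729) ^ n * ((27 / 4) ^ n * (27 / 4) ^ n))
      * (INR n / sqrt (INR n) ^ 2) * (3 * PI / sqrt (3 * PI) ^ 2))
    by (field; lra).
  rewrite Hp, Hs, Hx. field; lra.
Qed.

Lemma top_binom_bounds n : (1 <= n)%nat ->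
  main_term n * INR n / 18 * lower_corr (INR n) <= top_binom n
  <= main_term n * INR n / 18 * upper_corr (INR n).
Proof.
  intros Hn. pose proof (top_binom_main_term_sqr n Hn) as E.
  pose proof (top_binom_sqr_ge n Hn) as H1. pose proof (top_binom_sqr_le n Hn) as H2.
  pose proof (main_term_pos n Hn). pose proof (top_binom_pos n). pose proof PI_RGT_0.
  apply le_INR in Hn; simpl in Hn.
  pose proof (lower_corr_pos _ Hn). pose proof (upper_corr_pos _ Hn).
  set (c := main_term n * INR n / 18) in *.
  assert (Hc : 0 < c) by (unfold c; nra).
  assert (Hk : 0 < 64 * PI / 243 * c ^ 2).
  { apply Rmult_lt_0_compat; [lra|apply pow_lt, Hc]. }
  apply (Rmult_le_compat_r (64 * PI / 243 * c ^ 2)) in H1; [|lra].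
  apply (Rmult_le_compat_r (64 * PI / 243 * c ^ 2)) in H2; [|lra].
  replace (243 / (64 * PI) * lower_corr (INR n) ^ 2 * (64 * PI / 243 * c ^ 2))
    with ((c * lower_corr (INR n)) ^ 2) in H1 by (field; lra).
  replace (243 / (64 * PI) * upper_corr (INR n) ^ 2 * (64 * PI / 243 * c ^ 2))
    with ((c * upper_corr (INR n)) ^ 2) in H2 by (field; lra).
  rewrite <- Rmult_assoc, <- E in H1, H2.
  split; apply Rsqr_incr_0; rewrite ?Rsqr_pow2; try assumption;
    try (apply Rmult_le_pos); lra.
Qed.

Lemma A11_gt_main n : (1 <= n)%nat ->
  main_term n * (1 - 1387 / (72 * INR n)) < INR (A11 n).
Proof.
  intros Hn. pose proof (main_term_pos n Hn) as Hm.
  destruct (le_lt_dec n 19) as [Hs|Hs].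
  - (* The left-hand side is negative as [1387 / 72 > 19]. *)
    apply Rlt_le_trans with 0; [|apply pos_INR].
    apply le_INR in Hn, Hs. rewrite (INR_IZR_INZ 19) in Hs; simpl in Hn, Hs.
    assert (1 - 1387 / (72 * INR n) < 0); [|nra].
    replace (1 - 1387 / (72 * INR n)) with (- ((1387 - 72 * INR n) / (72 * INR n)))
      by (field; lra).
    apply Ropp_lt_gt_0_contravar, Rdiv_lt_0_compat; lra.
  - eapply Rlt_le_trans; [|apply A11_ge, Hn].
    pose proof (top_binom_bounds n Hn) as [H _].
    apply le_INR in Hs. rewrite (INR_IZR_INZ 20) in Hs; simpl in Hs. clear Hn.
    set (x := INR n) in *. unfold lower_ratio.
    assert (Hr : 0 <= (18 * x - 336) / x ^ 2).
    { apply Rmult_le_pos; [lra|]. apply Rlt_le, Rinv_0_lt_compat, pow_lt; lra. }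
    apply (Rmult_le_compat_l ((18 * x - 336) / x ^ 2)) in H; [|exact Hr].
    eapply Rlt_le_trans; [|exact H].
    unfold lower_corr.
    (* [1387 / 72 = 56 / 3 + 43 / 72], and the product of these two summands leaves the positive
       surplus [301 / 27]. *)
    replace ((18 * x - 336) / x ^ 2 * (main_term n * x / 18 * (1 - 43 / (72 * x))))
      with (main_term n * (1 - 1387 / (72 * x)) + main_term n * (301 / 27 / x ^ 2))
      by (field; lra).
    assert (0 < main_term n * (301 / 27 / x ^ 2)); [|lra].
    apply Rmult_lt_0_compat; [exact Hm|].
    apply Rdiv_lt_0_compat; [|apply pow_lt]; lra.
Qed.

Lemma A11_lt_main n : (1 <= n)%nat ->
  INR (A11 n) < main_term n * (1 - 1387 / (72 * INR n) + 5548 / (9 * INR n ^ 2)).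
Proof.
  intros Hn. pose proof (main_term_pos n Hn) as Hm.
  eapply Rle_lt_trans; [apply A11_le, Hn|].
  pose proof (top_binom_bounds n Hn) as [_ H].
  apply le_INR in Hn; simpl in Hn.
  set (x := INR n) in *. unfold upper_ratio.
  assert (Hr : 0 <= (18 * x ^ 2 - 336 * x + 9000) / x ^ 3).
  { apply Rmult_le_pos; [nra|]. apply Rlt_le, Rinv_0_lt_compat, pow_lt; lra. }
  apply (Rmult_le_compat_l ((18 * x ^ 2 - 336 * x + 9000) / x ^ 3)) in H; [|exact Hr].
  eapply Rle_lt_trans; [exact H|].
  unfold upper_corr.
  apply Rlt_0_minus.
  (* The terms up to order [1 / x] cancel. The coefficient [14134 / 135] is
     [5548 / 9 - 500 - 301 / 27 - 3 / 5], and the numerator is already positive at [x = 1]. *)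
  match goal with |- 0 < ?t => replace t with
    (main_term n * ((14134 / 135 * x ^ 2 + 27883 / 90 * x - 300) / x ^ 4)) by (field; lra) end.
  apply Rmult_lt_0_compat; [exact Hm|].
  apply Rdiv_lt_0_compat; [nra | apply pow_lt; lra].
Qed.

Theorem theorem1p8 :
  let main (n : nat) : R :=
    243 * (27 / 4) ^ n / (4 * sqrt (3 * PI) * Rpower (INR n) (3 / 2)) in
  let second (n : nat) : R :=
    337041 * (27 / 4) ^ n / (288 * sqrt (3 * PI) * Rpower (INR n) (5 / 2)) in
  let order (n : nat) : R := (27 / 4) ^ n / Rpower (INR n) (7 / 2) in
  (exists (C : R) (N : nat), forall n : nat, (1 <= n)%nat -> (N <= n)%nat ->
     Rabs (INR (A11 n) - (main n - second n)) <= C * order n)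
  /\
  (forall n : nat, (1 <= n)%nat ->
     exists theta : R,
       0 <= theta <= 1348164 / (36 * sqrt (3 * PI)) /\
       INR (A11 n) = main n - second n + theta * order n)
  /\
  (exists N : nat, forall n : nat, (1 <= n)%nat -> (N <= n)%nat ->
     main n * (1 - 1387 / (72 * INR n)) < INR (A11 n) /\
     INR (A11 n) <
       main n * (1 - 1387 / (72 * INR n) + 5548 / (9 * INR n ^ 2))).
Proof.
  intros main second order.
  assert (Hs : 0 < sqrt (3 * PI)) by (apply sqrt_lt_R0; pose proof PI_RGT_0; lra).
  assert (Hmain : forall n, (1 <= n)%nat -> main n = main_term n).
  { intros n Hn. unfold main, main_term.
    replace (3 / 2) with (INR 1 + 1 / 2) by (simpl; field).
    rewrite Rpower_half_odd, pow_1 by (apply lt_0_INR; lia). reflexivity. }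
  (* [337041 / 288 = (243 / 4) * (1387 / 72)]. *)
  assert (Hsecond : forall n, (1 <= n)%nat ->
    main n - second n = main_term n * (1 - 1387 / (72 * INR n))).
  { intros n Hn. rewrite (Hmain n Hn). unfold second, main_term.
    assert (Hx : 0 < INR n) by (apply lt_0_INR; lia).
    assert (0 < sqrt (INR n)) by (apply sqrt_lt_R0, Hx).
    replace (5 / 2) with (INR 2 + 1 / 2) by (simpl; field).
    rewrite Rpower_half_odd by exact Hx. field; lra. }
  assert (Horder : forall n, (1 <= n)%nat ->
    main_term n / INR n ^ 2 = 243 / (4 * sqrt (3 * PI)) * order n /\ 0 < order n).
  { intros n Hn. unfold order, main_term.
    assert (Hx : 0 < INR n) by (apply lt_0_INR; lia).
    assert (0 < sqrt (INR n)) by (apply sqrt_lt_R0, Hx).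
    replace (7 / 2) with (INR 3 + 1 / 2) by (simpl; field).
    rewrite Rpower_half_odd by exact Hx. split; [field; lra|].
    apply Rdiv_lt_0_compat; [|apply Rmult_lt_0_compat]; try apply pow_lt; lra. }
  assert (Htheta : forall n, (1 <= n)%nat ->
     exists theta : R,
       0 <= theta <= 1348164 / (36 * sqrt (3 * PI)) /\
       INR (A11 n) = main n - second n + theta * order n).
  { intros n Hn. destruct (Horder n Hn) as [Ho Hpos].
    pose proof (A11_gt_main n Hn) as H1. pose proof (A11_lt_main n Hn) as H2.
    assert (Hx : 0 < INR n) by (apply lt_0_INR; lia).
    replace (main_term n * (1 - 1387 / (72 * INR n) + 5548 / (9 * INR n ^ 2)))
      with (main_term n * (1 - 1387 / (72 * INR n))
        + 5548 / 9 * (main_term n / INR n ^ 2)) in H2 by (field; lra).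
    rewrite Ho in H2. rewrite (Hsecond n Hn).
    (* The error divided by its order; the two strict bounds on [A11 n] place it in the required
       interval, as [1348164 / 36 = (5548 / 9) * (243 / 4)]. *)
    exists ((INR (A11 n) - main_term n * (1 - 1387 / (72 * INR n))) / order n).
    split; [split|field; lra].
    - apply Rlt_le, Rdiv_lt_0_compat; lra.
    - apply (Rle_div_l _ _ _ Hpos).
      replace (1348164 / (36 * sqrt (3 * PI))) with
        (5548 / 9 * (243 / (4 * sqrt (3 * PI)))) by (field; lra).
      lra. }
  split; [|split; [exact Htheta|]].
  - exists (1348164 / (36 * sqrt (3 * PI))), 0%nat; intros n Hn _.
    destruct (Htheta n Hn) as [theta [Hb ->]].
    destruct (Horder n Hn) as [_ Hpos].
    replace (main n - second n + theta * order n - (main n - second n))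
      with (theta * order n) by ring.
    rewrite Rabs_pos_eq by (apply Rmult_le_pos; lra).
    apply Rmult_le_compat_r; lra.
  - exists 0%nat; intros n Hn _. rewrite (Hmain n Hn).
    split; [apply A11_gt_main|apply A11_lt_main]; exact Hn.
Qed.
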